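(* Let $F>0$ be fixed and, for integers $N\ge 3$ and $\varepsilon=1/N$, let $y_F$ be the uniform circular configuration of $N$ atoms with nearest neighbor interatomic spacing $F\varepsilon$. If $\phi\in C^3(0,\infty)$, $\phi'(2F)\ge0$, and $\phi''(2F)\le0$, then, as $\varepsilon\to0$, $$\inf_{u\in\mathcal U\setminus\{0\}}\frac{\delta^2\mathcal E^{\mathrm a}(y_F)[u,u]}{\|u'\|_{\ell^2_\varepsilon}^2}=\begin{cases}\min\left\{\phi''(F)+4\,\phi''(2F),\ \dfrac{\phi'(F)}{F}\right\}+\mathcal O(\varepsilon^2)&\text{if }N\text{ is even},\\[2mm]\min\left\{\phi''(F)+4\,\phi''(2F),\ \dfrac{\phi'(F)}{F}+\mathcal O(\varepsilon)\right\}+\mathcal O(\varepsilon^2)&\text{if }N\text{ is odd}.\end{cases}$$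
   Context: Let $\varepsilon=1/N$. $\mathcal Y$ is the set of sequences $y=\{y_\ell\}_{\ell\in\mathbb Z}$, $y_\ell\in\mathbb R^2$, with $y_{\ell+N}=y_\ell+(y_N-y_0)$ for all $\ell$. $\mathcal U$ is the set of $N$-periodic sequences $u=\{u_\ell\}_{\ell\in\mathbb Z}$ in $\mathbb R^2$ with $\sum_{\ell=1}^N u_\ell=0$. Backward difference: $y'_\ell=(y_\ell-y_{\ell-1})/\varepsilon$. $\|\cdot\|$ is the Euclidean norm on $\mathbb R^2$ and $\|v\|_{\ell^2_\varepsilon}=\left(\varepsilon\sum_{\ell=1}^N\|v_\ell\|^2\right)^{1/2}$. $\phi:(0,\infty)\to\mathbb R$ is the pair potential. The atomistic energy is $\mathcal E^{\mathrm a}(y)=\varepsilon\sum_{\ell=1}^N[\phi(\|y'_\ell\|)+\phi(\|y'_{\ell+1}+y'_\ell\|)]$. The second variation is $\delta^2\mathcal E(y)[u,v]=\frac{\partial^2}{\partial s\,\partial t}\mathcal E(y+su+tv)\big|_{s=t=0}$. The uniform circular configuration is $(y_F)_\ell=R(\cos(2\pi\varepsilon\ell),\sin(2\pi\varepsilon\ell))$ with $R$ determined by $F\varepsilon=2R\sin(\pi\varepsilon)$ (up to rigid motions). $\mathcal O(\varepsilon^k)$ denotes a real quantity $r_N$ with $|r_N|\le C\varepsilon^k$ for all sufficiently large $N$ of the given parity, with $C$ depending only on $\phi$ and $F$. *)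

(* Defs.v *)
From Stdlib Require Import Reals ZArith Lra.
From Coquelicot Require Import Coquelicot.

Open Scope R_scope.

Definition eps (N : nat) : R := / INR N.

(* Points of the plane are elements of [R * R].  Coquelicot's product norm,
   unlike the sup norm of other libraries, is the Euclidean one. *)
Lemma norm_R2 (x y : R) : norm (x, y) = sqrt (x ^ 2 + y ^ 2).
Proof.
change (norm (x, y)) with (sqrt (Rabs x ^ 2 + Rabs y ^ 2)).
now rewrite !pow2_abs.
Qed.

Definition displacement (N : nat) (u : Z -> R * R) : Prop :=
  (forall l : Z, u (l + Z.of_nat N)%Z = u l) /\
  sum_n_m (fun l : nat => u (Z.of_nat l)) 1 N = zero.

Definition bdiff (N : nat) (y : Z -> R * R) (l : Z) : R * R :=
  scal (/ eps N) (minus (y l) (y (l - 1)%Z)).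

Definition l2norm (N : nat) (v : Z -> R * R) : R :=
  sqrt (eps N * sum_n_m (fun l : nat => norm (v (Z.of_nat l)) ^ 2) 1 N).

(* Only the values of [phi] on (0, oo) matter as long as consecutive and
   next-to-consecutive atoms do not coincide. *)
Definition atomistic_energy (phi : R -> R) (N : nat) (y : Z -> R * R) : R :=
  eps N * sum_n_m (fun l : nat =>
    phi (norm (bdiff N y (Z.of_nat l))) +
    phi (norm (plus (bdiff N y (Z.of_nat l + 1)%Z) (bdiff N y (Z.of_nat l)))))
    1 N.

Definition second_variation (E : (Z -> R * R) -> R) (y u v : Z -> R * R) : R :=
  Derive (fun s : R =>
    Derive (fun t : R =>
      E (fun l : Z => plus (y l) (plus (scal s (u l)) (scal t (v l))))) 0) 0.

Definition rigid_motion (g : R * R -> R * R) : Prop :=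
  exists (theta : R) (b : R * R), forall p : R * R,
    g p = plus (cos theta * fst p - sin theta * snd p,
                sin theta * fst p + cos theta * snd p) b.

Definition uniform_circular (F : R) (N : nat) (y : Z -> R * R) : Prop :=
  exists (rho : R) (g : R * R -> R * R),
    F * eps N = 2 * rho * sin (PI * eps N) /\ rigid_motion g /\
    forall l : Z, y l = g (rho * cos (2 * PI * eps N * IZR l),
                           rho * sin (2 * PI * eps N * IZR l)).

(* [ex_derive_n phi 3 x] alone only says that the total function
   [Derive_n phi 2] is differentiable at [x], hence the quantifier over k. *)
Definition C3_pos (phi : R -> R) : Prop :=
  forall x : R, 0 < x ->
    (forall k : nat, (k <= 3)%nat -> ex_derive_n phi k x) /\
    continuous (Derive_n phi 3) x.

Definition rayleigh_quotients (phi : R -> R) (N : nat) (y : Z -> R * R)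
    (q : R) : Prop :=
  exists u : Z -> R * R,
    displacement N u /\ ~ (forall l : Z, u l = zero) /\
    q = second_variation (atomistic_energy phi N) y u u /
        l2norm N (bdiff N u) ^ 2.

Definition inf_rayleigh (phi : R -> R) (N : nat) (y : Z -> R * R) : Rbar :=
  Glb_Rbar (rayleigh_quotients phi N y).

(* Main.v *)
(* Write u' = a t + b n in the moving frame of tangents t and normals n of the
   circle.  With c = cos (pi eps), s = sin (pi eps) and r = 2 F c, the second
   variation becomes eps times the sum of
     phi''(F) a^2 + phi'(F)/F b^2 + phi''(r) X^2 + phi'(r)/r Y^2,
     X = c (a + a_+) + s (b - b_+),   Y = s (a_+ - a) + c (b + b_+),
   and replacing r by 2 F in the coefficients costs O(eps^2).
   Lower bound: the sum of X^2 is at most that of 4 a^2 + 4 s^2 b^2 by a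
   completion of the square, and Y^2 has a nonnegative limit coefficient.
   Upper bound: a = 1, b = 0 gives phi''(F) + 4 phi''(2F); a = 0 and b
   oscillating at the frequency closest to pi gives phi'(F)/F + O(eps^2).  The
   latter works for both parities, so r1 = 0 is possible when N is odd. *)

Require Import Defs.
From Stdlib Require Import ssreflect Reals ZArith Lra Lia.
From Coquelicot Require Import Coquelicot.
Open Scope R_scope.

(** * Calculus in one real variable *)

(** Near [x] the difference quotient stays within 1 of [l]. The linear bound turns an [eps^2] error
    in an argument into an [eps^2] error in the value. *)
Lemma is_derive_local_Lipschitz (f : R -> R) (x l : R) :
  is_derive f x l ->
  exists (L : R) (d : posreal), 0 <= L /\
    forall z : R, Rabs (z - x) < d -> Rabs (f z - f x) <= L * Rabs (z - x).
Proof.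
intros H.
apply is_derive_Reals in H.
destruct (H 1 Rlt_0_1) as [d Hd].
exists (Rabs l + 1), d; split; [pose proof (Rabs_pos l); lra|].
intros z Hz.
destruct (Req_dec z x) as [->|n].
- rewrite !Rminus_diag Rabs_R0; lra.
- assert (n' : z - x <> 0) by lra.
  specialize (Hd (z - x) n' Hz).
  replace (x + (z - x)) with z in Hd by ring.
  replace (f z - f x) with (((f z - f x) / (z - x) - l) * (z - x) + l * (z - x))
    by (field; lra).
  eapply Rle_trans; [apply Rabs_triang|].
  rewrite !Rabs_mult.
  pose proof (Rabs_pos (z - x)).
  apply Rlt_le in Hd.
  pose proof (Rmult_le_compat_r _ _ _ H0 Hd).
  lra.
Qed.

(** The first derivative is asked for only near [x], because [phi] is controlled on (0, oo) alone.
    The explicit witness [g'] can be matched with the inner [Derive] of [second_variation]. *)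
Definition has_derive2 (g : R -> R) (x l : R) : Prop :=
  exists g' : R -> R,
    locally x (fun s => is_derive g s (g' s)) /\ is_derive g' x l.

Lemma has_derive2_ext (f g : R -> R) (x l : R) :
  (forall s, f s = g s) -> has_derive2 f x l -> has_derive2 g x l.
Proof.
intros E [f' [H1 H2]]; exists f'; split; [|exact H2].
apply: filter_imp H1 => s; apply is_derive_ext, E.
Qed.

Lemma has_derive2_const (c x : R) : has_derive2 (fun _ => c) x 0.
Proof.
exists (fun _ => 0); split.
- apply filter_forall => s; apply: is_derive_const.
- apply: is_derive_const.
Qed.

Lemma has_derive2_plus (f g : R -> R) (x a b : R) :
  has_derive2 f x a -> has_derive2 g x b ->
  has_derive2 (fun s => f s + g s) x (a + b).
Proof.
intros [f' [H1 H2]] [g' [H3 H4]]; exists (fun s => f' s + g' s); split.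
- generalize (filter_and _ _ H1 H3); apply filter_imp => s [A B].
  apply: is_derive_plus A B.
- apply: is_derive_plus H2 H4.
Qed.

Lemma has_derive2_scal (k : R) (f : R -> R) (x a : R) :
  has_derive2 f x a -> has_derive2 (fun s => k * f s) x (k * a).
Proof.
intros [f' [H1 H2]]; exists (fun s => k * f' s); split.
- apply: filter_imp H1 => s H; apply: is_derive_scal H.
- apply: is_derive_scal H2.
Qed.

Lemma has_derive2_sum (f : nat -> R -> R) (a : nat -> R) (x : R) (n m : nat) :
  (forall l, has_derive2 (f l) x (a l)) ->
  has_derive2 (fun s => sum_n_m (fun l => f l s) n m) x (sum_n_m a n m).
Proof.
intros H.
induction m as [|m IH].
- destruct n as [|n].
  + rewrite sum_n_n.
    apply (has_derive2_ext (f 0%nat)); [|apply H].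
    intros s; now rewrite sum_n_n.
  + rewrite sum_n_m_zero; [|lia].
    apply (has_derive2_ext (fun _ => 0)); [|apply has_derive2_const].
    intros s; rewrite sum_n_m_zero; [reflexivity|lia].
- destruct (Compare_dec.le_lt_dec n (S m)) as [h|h].
  + rewrite sum_n_Sm; [|exact h].
    apply (has_derive2_ext (fun s => sum_n_m (fun l => f l s) n m + f (S m) s)).
    { intros s; now rewrite sum_n_Sm. }
    now apply has_derive2_plus.
  + rewrite sum_n_m_zero; [|lia].
    apply (has_derive2_ext (fun _ => 0)); [|apply has_derive2_const].
    intros s; rewrite sum_n_m_zero; [reflexivity|lia].
Qed.

(** With both directions equal to [u] the perturbation is y + (s + t) u, so the inner derivative at
    t = 0 is the derivative at s along a single line. This regrouping holds index by index, whence
    the extensionality hypothesis on [E]. *)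
Lemma second_variation_diag (E : (Z -> R * R) -> R) (y u : Z -> R * R) (l : R) :
  has_derive2 (fun s => E (fun k => plus (y k) (scal s (u k)))) 0 l ->
  (forall y1 y2, (forall k, y1 k = y2 k) -> E y1 = E y2) ->
  second_variation E y u u = l.
Proof.
intros [g' [H1 H2]] HE; unfold second_variation.
apply is_derive_unique.
apply: is_derive_ext_loc H2.
apply: filter_imp H1 => s Hs.
symmetry; apply is_derive_unique.
apply (is_derive_ext (fun t => (fun s => E (fun k => plus (y k) (scal s (u k)))) (s + t))).
{ intros t; apply HE; intros k.
  destruct (y k), (u k); unfold plus, scal; simpl.
  unfold prod_plus, prod_scal, plus, scal, mult; simpl; unfold mult; simpl.
  f_equal; ring. }
replace (g' s) with (scal 1 (g' s)) by (unfold scal; simpl; unfold mult; simpl; ring).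
apply (is_derive_comp (fun s => E (fun k => plus (y k) (scal s (u k)))) (fun t => s + t)).
- now rewrite Rplus_0_r.
- auto_derive; [exact I|ring].
Qed.

(** * Moving frames in the plane *)

(* The vector with components a along (-sin psi, cos psi) and b along
   (-cos psi, -sin psi), the tangent and inner normal of the circle at psi. *)
Definition frame (psi a b : R) : R * R :=
  (- a * sin psi - b * cos psi, a * cos psi - b * sin psi).

Lemma norm_frame (psi a b : R) : norm (frame psi a b) = sqrt (a ^ 2 + b ^ 2).
Proof.
unfold frame; rewrite norm_R2; f_equal.
pose proof (sin2_cos2 psi) as H; unfold Rsqr in H.
replace (a ^ 2 + b ^ 2) with
  ((a ^ 2 + b ^ 2) * (sin psi * sin psi + cos psi * cos psi)) by (rewrite H; ring).
ring.
Qed.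

(** The perturbed bond has length [sqrt (Q s)], whose first and second derivatives at 0 are p and
    q^2 / r. By the chain rule stretching is weighted by phi'' and transverse motion by the tension
    phi' / r. *)
Lemma has_derive2_potential (phi : R -> R) (r psi p q : R) :
  C3_pos phi -> 0 < r ->
  has_derive2 (fun s => phi (norm (plus (frame psi r 0) (scal s (frame psi p q))))) 0
    (Derive_n phi 2 r * p ^ 2 + Derive_n phi 1 r / r * q ^ 2).
Proof.
intros Hphi Hr.
assert (D1 : forall x, 0 < x -> is_derive phi x (Derive_n phi 1 x)).
{ intros x Hx; apply Derive_correct.
  exact (proj1 (Hphi x Hx) 1%nat ltac:(lia)). }
assert (D2 : is_derive (Derive_n phi 1) r (Derive_n phi 2 r)).
{ apply Derive_correct.
  exact (proj1 (Hphi r Hr) 2%nat ltac:(lia)). }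
set (Q := fun s => (r + s * p) ^ 2 + (s * q) ^ 2).
apply (has_derive2_ext (fun s => phi (sqrt (Q s)))).
{ intros s.
  replace (plus (frame psi r 0) (scal s (frame psi p q)))
    with (frame psi (r + s * p) (s * q)).
  - now rewrite norm_frame.
  - unfold frame, plus, scal; simpl; unfold prod_plus, prod_scal, plus, scal; simpl.
    unfold mult; simpl; f_equal; ring. }
assert (Q0 : sqrt (Q 0) = r).
{ unfold Q; replace ((r + 0 * p) ^ 2 + (0 * q) ^ 2) with (r ^ 2) by ring.
  apply sqrt_pow2; lra. }
assert (DQ : forall s, 0 < Q s -> is_derive (fun s => sqrt (Q s)) s
   ((p * (r + s * p) + q * (s * q)) / sqrt (Q s))).
{ intros s Hs; unfold Q in Hs |- *; auto_derive; [exact Hs|].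
  change ((r + s * p) * ((r + s * p) * 1) + s * q * (s * q * 1))
    with ((r + s * p) ^ 2 + (s * q) ^ 2).
  field; apply Rgt_not_eq, sqrt_lt_R0, Hs. }
assert (Qpos : locally 0 (fun s => 0 < Q s)).
{ assert (c : continuous Q 0).
  { apply: ex_derive_continuous; unfold Q; auto_derive; exact I. }
  apply (c (fun x => 0 < x)).
  apply (open_gt 0).
  unfold Q; nra. }
exists (fun s => ((p * (r + s * p) + q * (s * q)) / sqrt (Q s)) *
                  Derive_n phi 1 (sqrt (Q s))); split.
- apply: filter_imp Qpos => s Hs.
  apply (is_derive_comp phi (fun s => sqrt (Q s))).
  + apply D1, sqrt_lt_R0, Hs.
  + apply DQ, Hs.
- assert (Q0pos : 0 < Q 0) by (unfold Q; nra).
  assert (H1 : is_derive (fun s => Derive_n phi 1 (sqrt (Q s))) 0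
     (p * Derive_n phi 2 r)).
  { replace (p * Derive_n phi 2 r) with
      (scal ((p * (r + 0 * p) + q * (0 * q)) / sqrt (Q 0)) (Derive_n phi 2 r)).
    - apply (is_derive_comp (Derive_n phi 1) (fun s => sqrt (Q s))).
      + now rewrite Q0.
      + now apply DQ.
    - rewrite Q0; unfold scal; simpl; unfold mult; simpl; field; lra. }
  assert (H2 : is_derive (fun s => (p * (r + s * p) + q * (s * q)) / sqrt (Q s)) 0
     (q ^ 2 / r)).
  { evar_last.
    - apply (is_derive_div (fun s => p * (r + s * p) + q * (s * q)) (fun s => sqrt (Q s))
        0 (p ^ 2 + q ^ 2)).
      + auto_derive; [exact I|ring].
      + now apply DQ.
      + rewrite Q0; lra.
    - rewrite Q0; simpl; field; lra. }
  evar_last.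
  + apply (is_derive_mult _ _ _ _ _ H2 H1); intros; apply Rmult_comm.
  + rewrite Q0; unfold plus, mult; simpl; field; lra.
Qed.

(** Allows vectors given in the frames of two neighbouring bonds to be added in the frame halfway
    between them. *)
Lemma frame_rotate (alpha psi a b : R) :
  frame psi a b =
  frame (psi + alpha) (cos alpha * a + sin alpha * b) (cos alpha * b - sin alpha * a).
Proof.
pose proof (sin2_cos2 alpha) as H; unfold Rsqr in H.
unfold frame; rewrite sin_plus cos_plus; f_equal.
- transitivity ((- a * sin psi - b * cos psi) *
    (sin alpha * sin alpha + cos alpha * cos alpha)); [rewrite H|]; ring.
- transitivity ((a * cos psi - b * sin psi) *
    (sin alpha * sin alpha + cos alpha * cos alpha)); [rewrite H|]; ring.
Qed.

Lemma frame_plus (psi a b a' b' : R) :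
  plus (frame psi a b) (frame psi a' b') = frame psi (a + a') (b + b').
Proof. unfold frame, plus; simpl; unfold prod_plus, plus; simpl; f_equal; ring. Qed.

Lemma frame_scal (k psi a b : R) :
  scal k (frame psi a b) = frame psi (k * a) (k * b).
Proof.
unfold frame, scal; simpl; unfold prod_scal, scal; simpl; unfold mult; simpl.
f_equal; ring.
Qed.

Lemma frame_coordinates (psi : R) (v : R * R) :
  frame psi (snd v * cos psi - fst v * sin psi) (- fst v * cos psi - snd v * sin psi) = v.
Proof.
pose proof (sin2_cos2 psi) as H; unfold Rsqr in H.
destruct v as [x y]; unfold frame; simpl; f_equal.
- transitivity (x * (sin psi * sin psi + cos psi * cos psi)); [|rewrite H]; ring.
- transitivity (y * (sin psi * sin psi + cos psi * cos psi)); [|rewrite H]; ring.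
Qed.

(** * Waves and their backward differences *)

(** These Fourier modes give both the circular configuration and the building blocks of all trial
    displacements. *)
Definition wave (beta psi : R) (l : Z) : R * R :=
  (cos (beta * IZR l + psi), sin (beta * IZR l + psi)).

(** Expanding both points around the midpoint phase leaves only the chord, which is tangent to the
    circle at the midpoint. *)
Lemma minus_wave (beta psi : R) (l : Z) :
  minus (wave beta psi l) (wave beta psi (l - 1)) =
  frame (beta * IZR l + psi - beta / 2) (2 * sin (beta / 2)) 0.
Proof.
unfold wave, frame, minus, plus, opp; simpl; unfold prod_plus, prod_opp, plus, opp; simpl.
rewrite minus_IZR.
set (x := beta * IZR l + psi - beta / 2).
replace (beta * IZR l + psi) with (x + beta / 2) by (unfold x; field).
replace (beta * (IZR l - 1) + psi) with (x - beta / 2) by (unfold x; field).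
rewrite cos_plus sin_plus cos_minus sin_minus.
f_equal; ring.
Qed.

Lemma bdiff_wave (N : nat) (beta psi : R) (l : Z) :
  bdiff N (wave beta psi) l =
  frame (beta * IZR l + psi - beta / 2) (/ eps N * (2 * sin (beta / 2))) 0.
Proof. unfold bdiff; rewrite minus_wave frame_scal Rmult_0_r; reflexivity. Qed.

Lemma bdiff_plus (N : nat) (u v : Z -> R * R) (l : Z) :
  bdiff N (fun k => plus (u k) (v k)) l = plus (bdiff N u l) (bdiff N v l).
Proof.
unfold bdiff; rewrite -scal_distr_l; f_equal.
unfold minus; rewrite opp_plus -!plus_assoc; f_equal.
rewrite !plus_assoc; f_equal; apply plus_comm.
Qed.

Lemma bdiff_scal (N : nat) (k : R) (u : Z -> R * R) (l : Z) :
  bdiff N (fun k' => scal k (u k')) l = scal k (bdiff N u l).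
Proof.
unfold bdiff; rewrite -(scal_minus_distr_l k) !scal_assoc.
f_equal; unfold mult; simpl; ring.
Qed.

Lemma sum_telescope {G : AbelianGroup} (f : Z -> G) (n : nat) :
  sum_n_m (fun l : nat => minus (f (Z.of_nat l)) (f (Z.of_nat l - 1)%Z)) 1 n =
  minus (f (Z.of_nat n)) (f 0%Z).
Proof.
induction n as [|n IH].
- rewrite sum_n_m_zero; [|lia]; simpl; now rewrite minus_eq_zero.
- rewrite sum_n_Sm; [|lia]; rewrite IH.
  replace (Z.of_nat (S n) - 1)%Z with (Z.of_nat n) by lia.
  rewrite plus_comm; apply eq_sym, minus_trans.
Qed.

(** * Periodic displacements of mean zero *)

Lemma cos_sin_period_Z (x : R) (k : Z) :
  cos (x + 2 * IZR k * PI) = cos x /\ sin (x + 2 * IZR k * PI) = sin x.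
Proof.
destruct (Z_le_gt_dec 0 k) as [h|h].
- rewrite <- (Z2Nat.id k h), <- INR_IZR_INZ.
  now rewrite cos_period sin_period.
- set (n := Z.to_nat (- k)).
  assert (E : IZR k = - INR n).
  { unfold n; rewrite INR_IZR_INZ Z2Nat.id; [|lia]; rewrite opp_IZR; ring. }
  rewrite E.
  rewrite -(cos_period (x + 2 * - INR n * PI) n) -(sin_period (x + 2 * - INR n * PI) n).
  replace (x + 2 * - INR n * PI + 2 * INR n * PI) with x by ring; auto.
Qed.

Lemma INR_mult_eps (N : nat) : (0 < N)%nat -> INR N * eps N = 1.
Proof. intros h; apply Rinv_r, not_0_INR; lia. Qed.

Lemma eps_pos (N : nat) : (0 < N)%nat -> 0 < eps N.
Proof. intros h; apply Rinv_0_lt_compat, lt_0_INR, h. Qed.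

Lemma displacement_plus (N : nat) (u v : Z -> R * R) :
  displacement N u -> displacement N v ->
  displacement N (fun l => plus (u l) (v l)).
Proof.
intros [p1 z1] [p2 z2]; split.
- intros l; now rewrite p1 p2.
- rewrite (sum_n_m_plus (fun l => u (Z.of_nat l)) (fun l => v (Z.of_nat l))).
  rewrite z1 z2; apply plus_zero_l.
Qed.

Lemma displacement_scal (N : nat) (k : R) (u : Z -> R * R) :
  displacement N u -> displacement N (fun l => scal k (u l)).
Proof.
intros [p z]; split.
- intros l; now rewrite p.
- rewrite (sum_n_m_scal_l k (fun l => u (Z.of_nat l))) z.
  exact (scal_zero_r (V := prod_ModuleSpace R_Ring R_ModuleSpace R_ModuleSpace) k).
Qed.

(** The sine condition says that [k] is not a multiple of [N]. The wave is then itself a backward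
    difference of a wave of the same frequency, so its sum over a period telescopes to zero. *)
Lemma displacement_wave (N : nat) (k : Z) (psi : R) :
  (0 < N)%nat -> sin (PI * eps N * IZR k) <> 0 ->
  displacement N (wave (2 * PI * eps N * IZR k) psi).
Proof.
intros hN hk.
set (beta := 2 * PI * eps N * IZR k).
assert (per : forall psi' l, wave beta psi' (l + Z.of_nat N) = wave beta psi' l).
{ intros psi' l; unfold wave.
  assert (E : beta * IZR (l + Z.of_nat N) + psi' = beta * IZR l + psi' + 2 * IZR k * PI).
  { rewrite plus_IZR -INR_IZR_INZ; unfold beta.
    transitivity (2 * PI * eps N * IZR k * IZR l + psi' + 2 * IZR k * PI * (INR N * eps N)).
    - ring.
    - rewrite INR_mult_eps; [ring|exact hN]. }
  rewrite E.
  now destruct (cos_sin_period_Z (beta * IZR l + psi') k) as [-> ->]. }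
split; [apply per|].
(* The shift [beta / 2] compensates for the midpoint phase of the chord, and [- PI / 2] turns its
   tangent direction into the radial one. *)
set (v := wave beta (psi + beta / 2 - PI / 2)).
assert (hb : sin (beta / 2) <> 0).
{ unfold beta; replace (2 * PI * eps N * IZR k / 2) with (PI * eps N * IZR k) by field.
  exact hk. }
rewrite (sum_n_m_ext _ (fun l : nat => scal (/ (2 * sin (beta / 2)))
  (minus (v (Z.of_nat l)) (v (Z.of_nat l - 1)%Z)))).
- rewrite sum_n_m_scal_l sum_telescope.
  replace (v (Z.of_nat N)) with (v 0%Z) by (symmetry; apply (per _ 0%Z)).
  rewrite minus_eq_zero.
  exact (scal_zero_r (V := prod_ModuleSpace R_Ring R_ModuleSpace R_ModuleSpace) _).
- intros l; unfold v; rewrite minus_wave frame_scal.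
  replace (beta * IZR (Z.of_nat l) + (psi + beta / 2 - PI / 2) - beta / 2)
    with (beta * IZR (Z.of_nat l) + psi - PI / 2) by field.
  unfold wave, frame; rewrite sin_minus cos_minus cos_PI2 sin_PI2.
  f_equal; field; exact hb.
Qed.

(** * Sums over one period *)

Definition psum (N : nat) (f : Z -> R) : R :=
  sum_n_m (fun l : nat => f (Z.of_nat l)) 1 N.

Lemma psum_ext (N : nat) (f g : Z -> R) :
  (forall l, f l = g l) -> psum N f = psum N g.
Proof. intros H; apply sum_n_m_ext; intros l; apply H. Qed.

Lemma psum_plus (N : nat) (f g : Z -> R) :
  psum N (fun l => f l + g l) = psum N f + psum N g.
Proof.
exact (sum_n_m_plus (G := R_AbelianMonoid)
  (fun l => f (Z.of_nat l)) (fun l => g (Z.of_nat l)) 1 N).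
Qed.

Lemma psum_scal (N : nat) (k : R) (f : Z -> R) :
  psum N (fun l => k * f l) = k * psum N f.
Proof. exact (sum_n_m_mult_l (K := R_Ring) k (fun l => f (Z.of_nat l)) 1 N). Qed.

Lemma psum_le (N : nat) (f g : Z -> R) :
  (forall l, f l <= g l) -> psum N f <= psum N g.
Proof. intros H; apply sum_n_m_le; intros l; apply H. Qed.

Lemma psum_const (N : nat) (k : R) : psum N (fun _ => k) = INR N * k.
Proof. unfold psum; rewrite sum_n_m_const; do 2 f_equal; lia. Qed.

(** The two sums differ by the telescoped boundary term f (N + 1) - f 1, which vanishes by
    periodicity. *)
Lemma psum_shift (N : nat) (f : Z -> R) :
  (forall l, f (l + Z.of_nat N)%Z = f l) ->
  psum N (fun l => f (l + 1)%Z) = psum N f.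
Proof.
intros per.
assert (E : psum N (fun l => f (l + 1)%Z) = psum N f + (f (Z.of_nat N + 1)%Z - f 1%Z)).
{ assert (T := sum_telescope (G := R_AbelianGroup) (fun l => f (l + 1)%Z) N).
  change (f (Z.of_nat N + 1)%Z - f 1%Z)
    with (@minus R_AbelianGroup (f (Z.of_nat N + 1)%Z) (f (0 + 1)%Z)).
  rewrite -T.
  transitivity (psum N (fun l => f l + (f (l + 1)%Z - f (l - 1 + 1)%Z))).
  - apply psum_ext; intros l; replace (l - 1 + 1)%Z with l by lia; ring.
  - exact (psum_plus N f (fun l => f (l + 1)%Z - f (l - 1 + 1)%Z)). }
rewrite E Z.add_comm per; ring.
Qed.

Lemma psum_zero_inv (N : nat) (f : Z -> R) :
  (forall l, 0 <= f l) -> psum N f = 0 ->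
  forall k, (1 <= k <= N)%nat -> f (Z.of_nat k) = 0.
Proof.
intros pos; unfold psum.
assert (nn : forall n, 0 <= sum_n_m (fun l => f (Z.of_nat l)) 1 n).
{ intros n.
  replace 0 with (sum_n_m (fun _ : nat => 0) 1 n).
  - apply sum_n_m_le; intros l; apply pos.
  - rewrite sum_n_m_const; apply Rmult_0_r. }
induction N as [|N IH]; [lia|].
rewrite sum_n_Sm; [|lia].
unfold plus; simpl; intros E k hk.
pose proof (nn N); pose proof (pos (Z.of_nat (S N))) as p; simpl in p.
destruct (Nat.eq_dec k (S N)) as [->|n]; [simpl; lra|].
apply IH; [lra|lia].
Qed.

Lemma l2norm_sqr (N : nat) (v : Z -> R * R) :
  (0 < N)%nat -> l2norm N v ^ 2 = eps N * psum N (fun l => norm (v l) ^ 2).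
Proof.
intros hN; unfold l2norm; apply pow2_sqrt.
apply Rmult_le_pos; [apply Rlt_le, eps_pos, hN|].
rewrite -(Rmult_0_r (INR N)) -psum_const.
apply psum_le; intros l; apply pow2_ge_0.
Qed.

(** A vanishing strain makes [u] constant, and the zero mean makes the constant zero. Hence the
    denominators of the Rayleigh quotients never vanish. *)
Lemma displacement_bdiff_zero (N : nat) (u : Z -> R * R) :
  (0 < N)%nat -> displacement N u ->
  l2norm N (bdiff N u) ^ 2 = 0 -> forall l, u l = zero.
Proof.
intros hN [per sum0] H.
rewrite l2norm_sqr in H; [|exact hN].
pose proof (eps_pos N hN) as he.
apply Rmult_integral in H; destruct H as [H|H]; [lra|].
assert (Hb := psum_zero_inv N _ (fun l => pow2_ge_0 (norm (bdiff N u l))) H).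
assert (step : forall k, (1 <= k <= N)%nat -> u (Z.of_nat k) = u (Z.of_nat k - 1)%Z).
{ intros k hk; specialize (Hb k hk); simpl in Hb.
  assert (Hn : norm (bdiff N u (Z.of_nat k)) = 0).
  { apply Rmult_integral in Hb; destruct Hb as [?|Hb]; [assumption|].
    rewrite Rmult_1_r in Hb; exact Hb. }
  apply norm_eq_zero in Hn; unfold bdiff in Hn.
  destruct (u (Z.of_nat k)) as [x y], (u (Z.of_nat k - 1)%Z) as [x' y'].
  apply (f_equal (fun p => (fst p, snd p))) in Hn; cbn in Hn.
  unfold scal, mult, plus, opp, zero in Hn; cbn in Hn; unfold mult in Hn; cbn in Hn.
  injection Hn; intros h2 h1.
  apply Rmult_integral in h1; apply Rmult_integral in h2.
  pose proof (Rinv_0_lt_compat _ he).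
  f_equal; [destruct h1|destruct h2]; lra. }
assert (cst : forall k, (k <= N)%nat -> u (Z.of_nat k) = u 0%Z).
{ induction k as [|k IH]; intros hk; [reflexivity|].
  rewrite step; [|lia].
  replace (Z.of_nat (S k) - 1)%Z with (Z.of_nat k) by lia; apply IH; lia. }
assert (u0 : u 0%Z = zero).
{ rewrite (sum_n_m_ext_loc _ (fun _ : nat => u 0%Z)) in sum0.
  - assert (comp : forall n, sum_n_m (fun _ : nat => u 0%Z) 1 n =
      (INR n * fst (u 0%Z), INR n * snd (u 0%Z))).
    { induction n as [|n IH].
      - rewrite sum_n_m_zero; [|lia]; simpl; now rewrite !Rmult_0_l.
      - rewrite sum_n_Sm; [|lia]; rewrite IH S_INR.
        destruct (u 0%Z); unfold plus; simpl; unfold prod_plus, plus; simpl.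
        f_equal; ring. }
    rewrite comp in sum0; pose proof (lt_0_INR N hN).
    destruct (u 0%Z) as [x y]; unfold zero in sum0; simpl in sum0.
    unfold prod_zero, zero in sum0; simpl in sum0.
    injection sum0; intros h2 h1.
    apply Rmult_integral in h1; apply Rmult_integral in h2.
    unfold zero; simpl; unfold prod_zero, zero; simpl.
    f_equal; [destruct h1|destruct h2]; lra.
  - intros k hk; apply cst; lia. }
assert (perZ : forall (n : nat) l, u (l + Z.of_nat n * Z.of_nat N)%Z = u l).
{ induction n as [|n IH]; intros l; [f_equal; lia|].
  rewrite -(IH l) -(per (l + Z.of_nat n * Z.of_nat N)%Z); f_equal; lia. }
intros l.
(* The quotient of [l] by [N] may be negative; in that case [perZ] is applied starting from [l]
   instead of from the remainder. *)
assert (M : u l = u (l mod Z.of_nat N)%Z).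
{ pose proof (Z.div_mod l (Z.of_nat N) ltac:(lia)) as D.
  set (q := (l / Z.of_nat N)%Z) in *; set (r := (l mod Z.of_nat N)%Z) in *.
  destruct (Z_le_gt_dec 0 q) as [h|h].
  - rewrite -(perZ (Z.to_nat q) r); f_equal; lia.
  - rewrite -(perZ (Z.to_nat (- q)) l); f_equal; lia. }
rewrite M.
pose proof (Z.mod_pos_bound l (Z.of_nat N) ltac:(lia)) as B.
rewrite -(Z2Nat.id (l mod Z.of_nat N)%Z); [|lia].
rewrite cst; [exact u0|lia].
Qed.

(** * Second variation at the circular configuration *)

(** Density of the second variation for the strain u' = a t + b n: [A] and [B] weight the nearest
    neighbour bonds, [P] and [Q] the second neighbour bonds. The coefficients are free parameters so
    that the estimates below are purely algebraic. *)
Definition strain_density (A B P Q alpha : R) (a b : Z -> R) (l : Z) : R :=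
  A * a l ^ 2 + B * b l ^ 2 +
  (P * (cos alpha * (a l + a (l + 1)%Z) + sin alpha * (b l - b (l + 1)%Z)) ^ 2 +
   Q * (sin alpha * (a (l + 1)%Z - a l) + cos alpha * (b l + b (l + 1)%Z)) ^ 2).

(** The relation between [rho] and [F] fixes the chord length of the polygon. A rotation only shifts
    the phase and a translation drops out of differences. *)
Lemma bdiff_uniform_circular (F : R) (N : nat) (y : Z -> R * R) :
  0 < sin (PI * eps N) -> (0 < N)%nat -> uniform_circular F N y ->
  exists theta : R,
    forall l, bdiff N y l = frame (2 * PI * eps N * IZR l + theta) F 0.
Proof.
intros hs hN [rho [g [Hrho [[theta [b Hg]] Hy]]]].
exists (theta - PI * eps N); intros l.
assert (Y : forall k, y k = plus (scal rho (wave (2 * PI * eps N) theta k)) b).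
{ intros k; rewrite Hy Hg; f_equal.
  unfold wave, scal; simpl; unfold prod_scal, scal; simpl; unfold mult; simpl.
  rewrite cos_plus sin_plus; f_equal; ring. }
assert (E : bdiff N y l = bdiff N (fun k => scal rho (wave (2 * PI * eps N) theta k)) l).
{ unfold bdiff; f_equal; rewrite !Y.
  unfold minus; rewrite opp_plus (plus_comm (opp (scal rho _))) plus_assoc.
  now rewrite -(plus_assoc _ b) plus_opp_r plus_zero_r. }
rewrite E bdiff_scal bdiff_wave frame_scal Rmult_0_r.
f_equal; [field|].
replace (2 * PI * eps N / 2) with (PI * eps N) by field.
transitivity (2 * rho * sin (PI * eps N) * / eps N); [ring|].
rewrite -Hrho; field; apply Rgt_not_eq, eps_pos, hN.
Qed.

Lemma atomistic_energy_ext (phi : R -> R) (N : nat) (y z : Z -> R * R) :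
  (forall k, y k = z k) -> atomistic_energy phi N y = atomistic_energy phi N z.
Proof.
intros H; unfold atomistic_energy; f_equal; apply sum_n_m_ext; intros l.
unfold bdiff; now rewrite !H.
Qed.

(** Consecutive bonds differ in direction by 2 alpha. Rotating their frames by alpha and - alpha
    gives a common frame in which the second neighbour bond of [y] is purely tangential with length
    [r], so [has_derive2_potential] applies to both kinds of bonds. *)
Lemma second_variation_uniform_circular (phi : R -> R) (F : R) (N : nat)
    (y : Z -> R * R) (theta : R) (u : Z -> R * R) (a b : Z -> R) :
  C3_pos phi -> 0 < F -> 0 < cos (PI * eps N) ->
  (forall l, bdiff N y l = frame (2 * PI * eps N * IZR l + theta) F 0) ->
  (forall l, bdiff N u l = frame (2 * PI * eps N * IZR l + theta) (a l) (b l)) ->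
  let r := 2 * F * cos (PI * eps N) in
  second_variation (atomistic_energy phi N) y u u =
  eps N * psum N (strain_density (Derive_n phi 2 F) (Derive_n phi 1 F / F)
    (Derive_n phi 2 r) (Derive_n phi 1 r / r) (PI * eps N) a b).
Proof.
intros Hphi HF Hc Hy Hu r.
set (alpha := PI * eps N) in *.
assert (nn : forall (v : Z -> R * R) p q,
  (forall l, bdiff N v l = frame (2 * PI * eps N * IZR l + theta) (p l) (q l)) ->
  forall l, plus (bdiff N v (l + 1)%Z) (bdiff N v l) =
    frame (2 * PI * eps N * IZR l + theta + alpha)
      (cos alpha * (p l + p (l + 1)%Z) + sin alpha * (q l - q (l + 1)%Z))
      (sin alpha * (p (l + 1)%Z - p l) + cos alpha * (q l + q (l + 1)%Z))).
{ intros v p q Hv l; rewrite !Hv.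
  rewrite (frame_rotate alpha (_ * IZR l + theta)).
  rewrite (frame_rotate (- alpha) (_ * IZR (l + 1) + theta)).
  replace (2 * PI * eps N * IZR (l + 1) + theta + - alpha) with
    (2 * PI * eps N * IZR l + theta + alpha)
    by (rewrite plus_IZR; unfold alpha; ring).
  rewrite frame_plus cos_neg sin_neg; f_equal; ring. }
apply second_variation_diag; [|apply atomistic_energy_ext].
unfold atomistic_energy; apply has_derive2_scal.
apply has_derive2_sum; intros l.
apply has_derive2_plus.
- apply (has_derive2_ext (fun s => phi (norm (plus
    (frame (2 * PI * eps N * IZR (Z.of_nat l) + theta) F 0) (scal s
    (frame (2 * PI * eps N * IZR (Z.of_nat l) + theta)
      (a (Z.of_nat l)) (b (Z.of_nat l)))))))).
  + intros s; rewrite bdiff_plus bdiff_scal Hy Hu; reflexivity.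
  + now apply has_derive2_potential.
- apply (has_derive2_ext (fun s => phi (norm (plus
    (frame (2 * PI * eps N * IZR (Z.of_nat l) + theta + alpha) r 0) (scal s
    (plus (bdiff N u (Z.of_nat l + 1)%Z) (bdiff N u (Z.of_nat l)))))))).
  + intros s; rewrite !bdiff_plus !bdiff_scal.
    assert (E := nn y (fun _ => F) (fun _ => 0) Hy (Z.of_nat l)); simpl in E.
    replace (frame (2 * PI * eps N * IZR (Z.of_nat l) + theta + alpha) r 0) with
      (plus (bdiff N y (Z.of_nat l + 1)%Z) (bdiff N y (Z.of_nat l)))
      by (rewrite E; f_equal; unfold r; ring).
    do 2 f_equal.
    rewrite scal_distr_l -!plus_assoc; f_equal.
    rewrite !plus_assoc; f_equal; apply plus_comm.
  + rewrite (nn u a b Hu).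
    apply has_derive2_potential; [exact Hphi|].
    unfold r; apply Rmult_lt_0_compat; [lra|exact Hc].
Qed.

(** * Quadratic errors of the coefficients *)

Lemma cos_quadratic (x : R) : 0 <= 1 - cos x <= x ^ 2 / 2.
Proof.
pose proof (COS_bound x); split; [lra|].
replace x with (2 * (x / 2)) at 1 by field.
rewrite cos_2a_sin.
assert (h : forall t, 0 <= t -> Rabs (sin t) <= t).
{ intros t ht; destruct (Rle_lt_or_eq_dec _ _ ht) as [p| <-].
  - pose proof (sin_lt_x t p); apply Rabs_le; split; [|lra].
    destruct (Rle_lt_dec t PI) as [q|q].
    + pose proof (sin_ge_0 t ht q); lra.
    + pose proof (SIN_bound t); pose proof PI2_1; unfold PI2 in *; lra.
  - rewrite sin_0 Rabs_R0; lra. }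
assert (g : Rabs (sin (x / 2)) <= Rabs (x / 2)).
{ destruct (Rle_lt_dec 0 (x / 2)) as [p|p].
  - rewrite (Rabs_pos_eq (x / 2)); [apply h, p|exact p].
  - rewrite -(Rabs_Ropp (sin _)) -sin_neg -(Rabs_Ropp (x / 2)).
    rewrite (Rabs_pos_eq (- (x / 2))); [apply h; lra|lra]. }
apply Rsqr_le_abs_1 in g; unfold Rsqr in g; lra.
Qed.

(** The argument moves by at most x (PI eps)^2, and a function differentiable at [x] is Lipschitz
    there. *)
Lemma cos_eps_error (f : R -> R) (x l : R) :
  0 < x -> is_derive f x l ->
  exists (L : R) (N0 : nat), forall N : nat, (0 < N)%nat -> (N0 <= N)%nat ->
    Rabs (f (x * cos (PI * eps N)) - f x) <= L * eps N ^ 2.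
Proof.
intros hx Hf.
destruct (is_derive_local_Lipschitz f x l Hf) as [K [d [hK Hd]]].
(* This threshold gives x PI^2 eps < d, which keeps the argument inside the Lipschitz neighbourhood
   because eps <= 1. *)
destruct (INR_unbounded (x * PI ^ 2 / d)) as [N0 HN0].
exists (K * (x * PI ^ 2)), N0; intros N hN hN0.
pose proof (eps_pos N hN) as he.
pose proof (cond_pos d) as hd.
pose proof PI_RGT_0.
assert (e1 : eps N <= 1).
{ unfold eps; rewrite -Rinv_1; apply Rinv_le_contravar; [lra|].
  apply (le_INR 1); lia. }
assert (h : Rabs (x * cos (PI * eps N) - x) <= x * PI ^ 2 * eps N ^ 2).
{ pose proof (cos_quadratic (PI * eps N)) as [h1 h2].
  apply Rabs_le; split; nra. }
assert (small : x * PI ^ 2 * eps N ^ 2 < d).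
{ apply Rle_lt_trans with (x * PI ^ 2 * eps N).
  - apply Rmult_le_compat_l; nra.
  - apply Rmult_lt_reg_l with (INR N); [apply lt_0_INR, hN|].
    apply Rle_lt_trans with (x * PI ^ 2 * (INR N * eps N)); [lra|].
    rewrite INR_mult_eps; [|exact hN].
    apply le_INR in hN0.
    assert (x * PI ^ 2 < INR N * d) by (apply Rlt_div_l; [exact hd|lra]).
    lra. }
eapply Rle_trans; [apply Hd; lra|].
rewrite Rmult_assoc; apply Rmult_le_compat_l; [exact hK|lra].
Qed.

(** * Lower bound for the strain energy *)

(* Up to a telescoping term, the component X of the second neighbour strain
   along the second neighbour bond satisfies
   X^2 <= 2 c^2 (a^2 + a_+^2) + 2 s^2 (b^2 + b_+^2), because
   c^2 D^2 - 2 c s D S + s^2 S^2 >= 0 for D = a_+ - a and S = b + b_+. *)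
Lemma strain_density_lower (A B P Q P0 Q0 delta alpha : R) (a b : Z -> R) (l : Z) :
  P0 <= 0 -> 0 <= Q0 -> Rabs (P - P0) <= delta -> Rabs (Q - Q0) <= delta ->
  A * a l ^ 2 + B * b l ^ 2 +
  (2 * P0 - 2 * delta) * (a l ^ 2 + a (l + 1)%Z ^ 2) +
  (2 * P0 * sin alpha ^ 2 - 2 * delta) * (b l ^ 2 + b (l + 1)%Z ^ 2) +
  4 * P0 * cos alpha * sin alpha * (a l * b l - a (l + 1)%Z * b (l + 1)%Z)
  <= strain_density A B P Q alpha a b l.
Proof.
intros hP0 hQ0 hP hQ; unfold strain_density.
apply Rabs_le_between in hP; apply Rabs_le_between in hQ.
pose proof (sin2_cos2 alpha) as H; unfold Rsqr in H.
set (c := cos alpha) in *; set (s := sin alpha) in *.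
set (x := a l); set (y := b l); set (x' := a (l + 1)%Z); set (y' := b (l + 1)%Z).
set (X := c * (x + x') + s * (y - y')); set (Y := s * (x' - x) + c * (y + y')).
(* (X, Y) is the sum of rotated copies of (x, y) and (x', y'), so this is the parallelogram law. It
   absorbs the errors in [P] and [Q] together. *)
assert (hXY : X ^ 2 + Y ^ 2 <= 2 * (x ^ 2 + y ^ 2 + x' ^ 2 + y' ^ 2)).
{ assert (E : 2 * (x ^ 2 + y ^ 2 + x' ^ 2 + y' ^ 2) - (X ^ 2 + Y ^ 2) =
    (c * x + s * y - (c * x' - s * y')) ^ 2 + (c * y - s * x - (s * x' + c * y')) ^ 2 +
    2 * (x ^ 2 + y ^ 2 + x' ^ 2 + y' ^ 2) * (1 - (s * s + c * c)))
    by (unfold X, Y; ring).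
  rewrite H in E.
  pose proof (pow2_ge_0 (c * x + s * y - (c * x' - s * y'))).
  pose proof (pow2_ge_0 (c * y - s * x - (s * x' + c * y'))).
  lra. }
assert (hX : X ^ 2 <= 2 * (x ^ 2 + x' ^ 2) + 2 * s ^ 2 * (y ^ 2 + y' ^ 2) +
  4 * c * s * (x * y - x' * y')).
{ assert (E : 2 * (x ^ 2 + x' ^ 2) + 2 * s ^ 2 * (y ^ 2 + y' ^ 2) +
    4 * c * s * (x * y - x' * y') - X ^ 2 =
    (c * (x' - x) - s * (y + y')) ^ 2 + 2 * (1 - c * c) * (x ^ 2 + x' ^ 2))
    by (unfold X; ring).
  pose proof (pow2_ge_0 (c * (x' - x) - s * (y + y'))).
  replace (1 - c * c) with (s * s) in E by lra.
  pose proof (Rmult_le_pos _ _ (Rle_0_sqr s)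
    (Rplus_le_le_0_compat _ _ (pow2_ge_0 x) (pow2_ge_0 x'))) as h.
  unfold Rsqr in h; lra. }
pose proof (pow2_ge_0 X) as pX; pose proof (pow2_ge_0 Y) as pY.
assert (h1 : P0 * X ^ 2 >= P0 * (2 * (x ^ 2 + x' ^ 2) + 2 * s ^ 2 * (y ^ 2 + y' ^ 2) +
  4 * c * s * (x * y - x' * y'))).
{ apply Rle_ge, Rmult_le_compat_neg_l; assumption. }
assert (h2 : (P0 - delta) * X ^ 2 <= P * X ^ 2) by (apply Rmult_le_compat_r; lra).
assert (h3 : (Q0 - delta) * Y ^ 2 <= Q * Y ^ 2) by (apply Rmult_le_compat_r; lra).
assert (h4 : 0 <= Q0 * Y ^ 2) by (apply Rmult_le_pos; assumption).
assert (h5 : delta * (X ^ 2 + Y ^ 2) <= delta * (2 * (x ^ 2 + y ^ 2 + x' ^ 2 + y' ^ 2)))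
  by (apply Rmult_le_compat_l; lra).
lra.
Qed.

(** Shift invariance merges the terms at l and l + 1 and cancels the products a b. The sine
    correction belongs to the normal part only, but as P0 <= 0 it may also be charged to the
    tangential part, which yields one common constant. *)
Lemma psum_strain_density_lower (A B P Q P0 Q0 delta alpha : R) (N : nat) (a b : Z -> R) :
  P0 <= 0 -> 0 <= Q0 -> Rabs (P - P0) <= delta -> Rabs (Q - Q0) <= delta ->
  (forall l, a (l + Z.of_nat N)%Z = a l) -> (forall l, b (l + Z.of_nat N)%Z = b l) ->
  (Rmin (A + 4 * P0) B + 4 * P0 * sin alpha ^ 2 - 4 * delta) *
    psum N (fun l => a l ^ 2 + b l ^ 2)
  <= psum N (strain_density A B P Q alpha a b).
Proof.
intros hP0 hQ0 hP hQ pa pb.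
assert (sa := psum_shift N (fun l => a l ^ 2) (fun l => f_equal (fun x => x ^ 2) (pa l))).
assert (sb := psum_shift N (fun l => b l ^ 2) (fun l => f_equal (fun x => x ^ 2) (pb l))).
assert (sab := psum_shift N (fun l => a l * b l) (fun l => f_equal2 Rmult (pa l) (pb l))).
simpl in sa, sb, sab.
assert (pos : forall f : Z -> R, 0 <= psum N (fun l => f l ^ 2)).
{ intros f; rewrite -(Rmult_0_r (INR N)) -psum_const.
  apply psum_le; intros l; apply pow2_ge_0. }
pose proof (pos a); pose proof (pos b).
eapply Rle_trans;
  [|apply psum_le; intros l; apply (strain_density_lower A B P Q P0 Q0 delta);
    eassumption].
rewrite [X in _ <= X](psum_ext N _ (fun l => (A + 2 * P0 - 2 * delta) * a l ^ 2 +
  ((B + 2 * P0 * sin alpha ^ 2 - 2 * delta) * b l ^ 2 +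
  ((2 * P0 - 2 * delta) * a (l + 1)%Z ^ 2 +
  ((2 * P0 * sin alpha ^ 2 - 2 * delta) * b (l + 1)%Z ^ 2 +
  (4 * P0 * cos alpha * sin alpha * (a l * b l) +
   - (4 * P0 * cos alpha * sin alpha) * (a (l + 1)%Z * b (l + 1)%Z)))))));
  [|intros l; ring].
rewrite !psum_plus !psum_scal.
simpl in *; rewrite sa sb sab.
set (Sa := psum N (fun l => a l * (a l * 1))) in *.
set (Sb := psum N (fun l => b l * (b l * 1))) in *.
pose proof (Rmin_l (A + 4 * P0) B); pose proof (Rmin_r (A + 4 * P0) B).
set (M := Rmin (A + 4 * P0) B) in *.
pose proof (Rmult_le_compat_r Sa M (A + 4 * P0) ltac:(assumption) ltac:(assumption)).
pose proof (Rmult_le_compat_r Sb M B ltac:(assumption) ltac:(assumption)).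
pose proof (Rmult_le_pos _ _ (Rle_0_sqr (sin alpha)) (pos a)) as h.
unfold Rsqr in h; simpl in h; fold Sa in h.
assert (P0 * (sin alpha * sin alpha * Sa) <= 0) by nra.
lra.
Qed.

(** * Strain coordinates *)

(** The coordinates are periodic because the frame makes exactly one full turn in [N] steps. *)
Lemma bdiff_coordinates (N : nat) (u : Z -> R * R) (theta : R) :
  (0 < N)%nat -> displacement N u ->
  exists a b : Z -> R,
    (forall l, a (l + Z.of_nat N)%Z = a l) /\
    (forall l, b (l + Z.of_nat N)%Z = b l) /\
    forall l, bdiff N u l = frame (2 * PI * eps N * IZR l + theta) (a l) (b l).
Proof.
intros hN [per _].
set (psi := fun l : Z => 2 * PI * eps N * IZR l + theta).
assert (turn : forall l, psi (l + Z.of_nat N)%Z = psi l + 2 * IZR 1 * PI).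
{ intros l; unfold psi; rewrite plus_IZR -INR_IZR_INZ.
  transitivity (2 * PI * eps N * IZR l + theta + 2 * PI * (INR N * eps N)); [ring|].
  rewrite INR_mult_eps; [ring|exact hN]. }
assert (pb : forall l, bdiff N u (l + Z.of_nat N)%Z = bdiff N u l).
{ intros l; unfold bdiff; rewrite per.
  replace (l + Z.of_nat N - 1)%Z with (l - 1 + Z.of_nat N)%Z by lia.
  now rewrite per. }
exists (fun l => snd (bdiff N u l) * cos (psi l) - fst (bdiff N u l) * sin (psi l)),
  (fun l => - fst (bdiff N u l) * cos (psi l) - snd (bdiff N u l) * sin (psi l)).
split; [|split]; intros l.
- rewrite pb turn; now destruct (cos_sin_period_Z (psi l) 1) as [-> ->].
- rewrite pb turn; now destruct (cos_sin_period_Z (psi l) 1) as [-> ->].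
- symmetry; apply frame_coordinates.
Qed.

Lemma l2norm_frame (N : nat) (u : Z -> R * R) (psi a b : Z -> R) :
  (0 < N)%nat -> (forall l, bdiff N u l = frame (psi l) (a l) (b l)) ->
  l2norm N (bdiff N u) ^ 2 = eps N * psum N (fun l => a l ^ 2 + b l ^ 2).
Proof.
intros hN H; rewrite l2norm_sqr; [|exact hN].
f_equal; apply psum_ext; intros l; rewrite H norm_frame; apply pow2_sqrt.
apply Rplus_le_le_0_compat; apply pow2_ge_0.
Qed.

(** Two vectors of equal length add up along their mean direction, and the quarter turn presents
    that direction as a normal. Two waves thereby combine into a purely normal strain. *)
Lemma frame_plus_mean (chi chi' k : R) :
  plus (frame chi k 0) (frame chi' k 0) =
  frame ((chi + chi') / 2 - PI / 2) 0 (2 * k * cos ((chi - chi') / 2)).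
Proof.
set (m := (chi + chi') / 2); set (d := (chi - chi') / 2).
replace chi with (m + d) by (unfold m, d; field).
replace chi' with (m - d) by (unfold m, d; field).
unfold frame, plus; simpl; unfold prod_plus, plus; simpl.
rewrite (sin_minus m (PI / 2)) (cos_minus m (PI / 2)) cos_PI2 sin_PI2.
rewrite cos_plus sin_plus cos_minus sin_minus; f_equal; ring.
Qed.

Lemma sin_PI_eps_pos (N k : nat) :
  (0 < k < N)%nat -> 0 < sin (PI * eps N * INR k).
Proof.
intros hk; assert (hN : (0 < N)%nat) by lia.
pose proof (eps_pos N hN); pose proof PI_RGT_0.
assert (0 < INR k) by (apply lt_0_INR; lia).
apply sin_gt_0.
- apply Rmult_lt_0_compat; [apply Rmult_lt_0_compat|]; assumption.
- rewrite -[X in _ < X]Rmult_1_r -(INR_mult_eps N hN) Rmult_assoc.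
  apply Rmult_lt_compat_l; [assumption|].
  rewrite Rmult_comm; apply Rmult_lt_compat_r; [assumption|apply lt_INR; lia].
Qed.

(** * Two-sided estimate of the infimum at fixed [N] *)

Lemma inf_rayleigh_error (phi : R -> R) (F : R) (N : nat) (y : Z -> R * R)
    (P0 Q0 delta : R) :
  C3_pos phi -> 0 < F -> (5 <= N)%nat -> uniform_circular F N y ->
  P0 <= 0 -> 0 <= Q0 ->
  let r := 2 * F * cos (PI * eps N) in
  Rabs (Derive_n phi 2 r - P0) <= delta ->
  Rabs (Derive_n phi 1 r / r - Q0) <= delta ->
  exists e : R,
    Rabs e <= 8 * delta + (Q0 - 4 * P0) * (PI * eps N) ^ 2 /\
    inf_rayleigh phi N y =
      Finite (Rmin (Derive_n phi 2 F + 4 * P0) (Derive_n phi 1 F / F) + e).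
Proof.
intros Hphi HF hN Hy hP0 hQ0 r hP hQ.
assert (hN0 : (0 < N)%nat) by lia.
set (alpha := PI * eps N) in *.
set (A := Derive_n phi 2 F); set (B := Derive_n phi 1 F / F).
set (P := Derive_n phi 2 r) in *; set (Q := Derive_n phi 1 r / r) in *.
pose proof (eps_pos N hN0) as he.
pose proof PI_RGT_0 as hpi.
assert (hd : 0 <= delta) by (eapply Rle_trans; [apply Rabs_pos|exact hP]).
assert (hs : 0 < sin alpha).
{ assert (h := sin_PI_eps_pos N 1 ltac:(lia)).
  simpl in h; now rewrite Rmult_1_r in h. }
assert (hc : 0 < cos alpha).
{ apply cos_gt_0; unfold alpha; [nra|].
  assert (2 * eps N < 1).
  { rewrite -(INR_mult_eps N hN0); apply Rmult_lt_compat_r; [exact he|].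
    apply (lt_INR 2); lia. }
  nra. }
pose proof (sin2_cos2 alpha) as hsc; unfold Rsqr in hsc.
assert (hs2 : sin alpha ^ 2 <= alpha ^ 2).
{ pose proof (sin_lt_x alpha ltac:(unfold alpha; nra)); nra. }
destruct (bdiff_uniform_circular F N y hs hN0 Hy) as [theta Hth].
assert (SV := fun u a b => second_variation_uniform_circular phi F N y theta u a b
  Hphi HF hc Hth).
cbv zeta in SV; fold alpha in SV; fold r in SV; fold A in SV; fold B in SV;
  fold P in SV; fold Q in SV.
set (m := Rmin (A + 4 * P0) B + 4 * P0 * sin alpha ^ 2 - 4 * delta).
assert (LB : forall u, displacement N u ->
  m * l2norm N (bdiff N u) ^ 2 <= second_variation (atomistic_energy phi N) y u u).
{ intros u hu.
  destruct (bdiff_coordinates N u theta hN0 hu) as [a [b [pa [pb H]]]].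
  rewrite (SV u a b H) (l2norm_frame N u _ a b hN0 H).
  rewrite -Rmult_assoc (Rmult_comm m) Rmult_assoc.
  apply Rmult_le_compat_l; [lra|].
  now apply psum_strain_density_lower with (Q0 := Q0). }
assert (Wpos : forall u, 0 <= l2norm N (bdiff N u) ^ 2) by (intros; apply pow2_ge_0).
(* Lower bounds are used with the denominator cleared. If the strain vanishes, the inequality
   reduces to nonnegativity of the second variation, which [LB] supplies. *)
assert (IB : forall i : R, is_lb_Rbar (rayleigh_quotients phi N y) i ->
  forall u a b, displacement N u ->
  (forall l, bdiff N u l = frame (2 * PI * eps N * IZR l + theta) (a l) (b l)) ->
  i * psum N (fun l => a l ^ 2 + b l ^ 2) <=
  psum N (strain_density A B P Q alpha a b)).
{ intros i hi u a b hu H.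
  apply Rmult_le_reg_l with (eps N); [exact he|].
  rewrite -(SV u a b H) -Rmult_assoc (Rmult_comm _ i) Rmult_assoc.
  rewrite -(l2norm_frame N u _ a b hN0 H).
  assert (L := LB u hu).
  destruct (Req_dec (l2norm N (bdiff N u) ^ 2) 0) as [z|nz].
  - rewrite z Rmult_0_r; rewrite z Rmult_0_r in L; exact L.
  - pose proof (Wpos u).
    apply Rle_div_r; [lra|].
    apply hi; exists u; split; [exact hu|split; [|reflexivity]].
    intros u0; apply nz; rewrite l2norm_sqr; [|exact hN0].
    rewrite (psum_ext N _ (fun _ => 0)); [rewrite psum_const; ring|].
    intros l; unfold bdiff; rewrite !u0 minus_eq_zero.
    rewrite (scal_zero_r (V := prod_ModuleSpace R_Ring R_ModuleSpace R_ModuleSpace)).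
    rewrite (norm_R2 0 0); replace (0 ^ 2 + 0 ^ 2) with 0 by ring.
    rewrite sqrt_0; ring. }
assert (LBq : is_lb_Rbar (rayleigh_quotients phi N y) m).
{ intros q [u [hu [nz ->]]]; simpl.
  assert (l2norm N (bdiff N u) ^ 2 <> 0).
  { intros z; apply nz, (displacement_bdiff_zero N u hN0 hu z). }
  pose proof (Wpos u).
  apply Rle_div_r; [lra|]; apply LB, hu. }
set (k := / eps N * (2 * sin alpha)).
assert (kpos : 0 < k).
{ apply Rmult_lt_0_compat; [apply Rinv_0_lt_compat, he|lra]. }
(* The infinitesimal dilation of the circle: the phase [alpha] offsets the midpoint shift, so its
   strain is constant and tangential. *)
set (u1 := wave (2 * PI * eps N * IZR 1) (theta + alpha)).
assert (d1 : displacement N u1).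
{ apply displacement_wave; [exact hN0|].
  rewrite Rmult_1_r; apply Rgt_not_eq, hs. }
assert (h1 : forall l, bdiff N u1 l =
  frame (2 * PI * eps N * IZR l + theta) ((fun _ => k) l) ((fun _ => 0) l)).
{ intros l; unfold u1; rewrite bdiff_wave; f_equal.
  - unfold alpha; field.
  - unfold k; do 3 f_equal; unfold alpha; field. }
assert (U1 : forall i : R, is_lb_Rbar (rayleigh_quotients phi N y) i ->
  i <= A + 4 * P * cos alpha ^ 2).
{ intros i hi; assert (h := IB i hi u1 _ _ d1 h1).
  rewrite (psum_ext N _ (fun _ => k ^ 2)) in h; [|intros; cbv beta; ring].
  rewrite [X in _ <= X](psum_ext N _ (fun _ => (A + 4 * P * cos alpha ^ 2) * k ^ 2)) in h;
    [|intros; unfold strain_density; cbv beta; ring].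
  rewrite !psum_const in h.
  assert (0 < INR N * k ^ 2).
  { apply Rmult_lt_0_compat; [apply lt_0_INR, hN0|apply pow_lt, kpos]. }
  apply Rmult_le_reg_r with (INR N * k ^ 2); [assumption|lra]. }
(* The trial w below has normal strain proportional to cos (gamma l + shift) with
   gamma = 2 PI n / N and n = floor (N / 2), the admissible frequency closest
   to PI; 5 <= N ensures that 1 - n and 1 + n are nonzero modulo N. *)
set (n := Nat.div2 N).
assert (hn : (2 <= n /\ n + 1 < N)%nat /\ Rabs (INR N - 2 * INR n) <= 1).
{ pose proof (Nat.div2_odd N) as D; fold n in D.
  assert (D' : INR N = 2 * INR n + INR (Nat.b2n (Nat.odd N))).
  { rewrite {1}D plus_INR mult_INR; simpl; ring. }
  rewrite D'; destruct (Nat.odd N); simpl in *; split; try lia;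
    apply Rabs_le; split; lra. }
destruct hn as [hn hpar].
set (gamma := 2 * PI * eps N * INR n).
set (beta1 := 2 * PI * eps N * IZR (1 + Z.of_nat n)).
set (beta2 := 2 * PI * eps N * IZR (1 - Z.of_nat n)).
assert (s1 : sin (PI * eps N * IZR (1 + Z.of_nat n)) <> 0).
{ replace (1 + Z.of_nat n)%Z with (Z.of_nat (n + 1)) by lia.
  rewrite -INR_IZR_INZ; apply Rgt_not_eq, sin_PI_eps_pos; lia. }
assert (s2 : sin (PI * eps N * IZR (1 - Z.of_nat n)) <> 0).
{ replace (1 - Z.of_nat n)%Z with (- Z.of_nat (n - 1))%Z by lia.
  rewrite opp_IZR -INR_IZR_INZ Ropp_mult_distr_r_reverse sin_neg.
  apply Ropp_neq_0_compat, Rgt_not_eq, sin_PI_eps_pos; lia. }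
replace (PI * eps N * IZR (1 + Z.of_nat n)) with (beta1 / 2) in s1
  by (unfold beta1; field).
replace (PI * eps N * IZR (1 - Z.of_nat n)) with (beta2 / 2) in s2
  by (unfold beta2; field).
assert (hb1 : beta1 = 2 * PI * eps N + gamma).
{ unfold beta1, gamma; rewrite plus_IZR -INR_IZR_INZ; ring. }
assert (hb2 : beta2 = 2 * PI * eps N - gamma).
{ unfold beta2, gamma; rewrite minus_IZR -INR_IZR_INZ; ring. }
(* The crossed weights give both waves chords of the same length, as [frame_plus_mean] requires. The
   phases make the mean direction the normal of the moving frame and the half difference gamma l +
   shift. *)
set (w := fun (shift : R) (l : Z) =>
  plus (scal (sin (beta2 / 2)) (wave beta1 (theta + PI / 2 + beta1 / 2 + shift) l))
       (scal (sin (beta1 / 2)) (wave beta2 (theta + PI / 2 + beta2 / 2 - shift) l))).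
set (K := 2 * (sin (beta2 / 2) * (/ eps N * (2 * sin (beta1 / 2))))).
assert (hK : 0 < K ^ 2).
{ apply pow2_gt_0; unfold K.
  pose proof (Rinv_neq_0_compat (eps N) ltac:(lra)).
  repeat apply Rmult_integral_contrapositive_currified; try assumption; lra. }
assert (dw : forall shift, displacement N (w shift)).
{ intros shift; unfold w; apply displacement_plus; apply displacement_scal;
  apply displacement_wave; try exact hN0.
  - replace (PI * eps N * IZR (1 + Z.of_nat n)) with (beta1 / 2)
      by (unfold beta1; field); exact s1.
  - replace (PI * eps N * IZR (1 - Z.of_nat n)) with (beta2 / 2)
      by (unfold beta2; field); exact s2. }
assert (hw : forall shift l, bdiff N (w shift) l =
  frame (2 * PI * eps N * IZR l + theta)
    ((fun _ => 0) l) ((fun l => K * cos (gamma * IZR l + shift)) l)).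
{ intros shift l; unfold w; rewrite bdiff_plus !bdiff_scal !bdiff_wave !frame_scal.
  rewrite !Rmult_0_r.
  replace (sin (beta1 / 2) * (/ eps N * (2 * sin (beta2 / 2)))) with
    (sin (beta2 / 2) * (/ eps N * (2 * sin (beta1 / 2)))) by ring.
  rewrite frame_plus_mean; f_equal.
  - rewrite hb1 hb2; field.
  - unfold K; do 2 f_equal; rewrite hb1 hb2; field. }
(* Adding the trials with phases 0 and - PI / 2 makes the summands independent
   of l, so no trigonometric sum has to be evaluated. *)
assert (U2 : forall i : R, is_lb_Rbar (rayleigh_quotients phi N y) i ->
  i <= B + P * sin alpha ^ 2 * (2 - 2 * cos gamma) +
       Q * cos alpha ^ 2 * (2 + 2 * cos gamma)).
{ intros i hi.
  assert (e1 := IB i hi _ _ _ (dw 0) (hw 0)).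
  assert (e2 := IB i hi _ _ _ (dw (- (PI / 2))) (hw (- (PI / 2)))).
  assert (e := Rplus_le_compat _ _ _ _ e1 e2).
  rewrite -Rmult_plus_distr_l -!psum_plus in e.
  assert (tr : forall l, cos (gamma * IZR l) ^ 2 + sin (gamma * IZR l) ^ 2 = 1).
  { intros l; pose proof (sin2_cos2 (gamma * IZR l)) as h; unfold Rsqr in h; lra. }
  assert (tg : cos gamma ^ 2 + sin gamma ^ 2 = 1).
  { pose proof (sin2_cos2 gamma) as h; unfold Rsqr in h; lra. }
  assert (sh : forall x, cos (x + - (PI / 2)) = sin x).
  { intros x; rewrite cos_plus cos_neg sin_neg cos_PI2 sin_PI2; ring. }
  set (T := B + P * sin alpha ^ 2 * (2 - 2 * cos gamma) +
       Q * cos alpha ^ 2 * (2 + 2 * cos gamma)).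
  rewrite (psum_ext N _ (fun _ => K ^ 2)) in e.
  2: { intros l; rewrite sh Rplus_0_r -[RHS]Rmult_1_r -(tr l); ring. }
  rewrite [X in _ <= X](psum_ext N _ (fun _ => T * K ^ 2)) in e.
  2: { intros l; unfold strain_density, T; rewrite !sh !Rplus_0_r plus_IZR.
       rewrite !Rmult_plus_distr_l !Rmult_1_r cos_plus sin_plus.
       set (C := cos (gamma * IZR l)); set (S := sin (gamma * IZR l)).
       set (g := cos gamma); set (h := sin gamma).
       assert (tr' : S ^ 2 = 1 - C ^ 2) by (pose proof (tr l); unfold S, C; lra).
       assert (tg' : h ^ 2 = 1 - g ^ 2) by (unfold h, g; lra).
       ring_simplify; rewrite tr' tg'; ring. }
  rewrite !psum_const in e.
  assert (0 < INR N * K ^ 2).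
  { apply Rmult_lt_0_compat; [apply lt_0_INR, hN0|exact hK]. }
  apply Rmult_le_reg_r with (INR N * K ^ 2); [assumption|lra]. }
(* Parity enters only through |N - 2 n| <= 1: it puts gamma within alpha of PI, so cos gamma is
   within alpha^2 / 2 of -1. *)
assert (hg : 0 <= 2 + 2 * cos gamma <= alpha ^ 2).
{ pose proof (COS_bound gamma); split; [lra|].
  assert (E : PI - gamma = alpha * (INR N - 2 * INR n)).
  { unfold gamma, alpha; transitivity (PI * (INR N * eps N) - 2 * PI * eps N * INR n);
    [rewrite INR_mult_eps; [ring|exact hN0]|ring]. }
  pose proof (cos_quadratic (PI - gamma)) as [_ h].
  rewrite cos_minus cos_PI sin_PI in h.
  rewrite E in h.
  apply Rabs_le_between in hpar.
  assert ((INR N - 2 * INR n) ^ 2 <= 1) by nra.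
  pose proof (pow2_ge_0 alpha).
  nra. }
destruct (Glb_Rbar_correct (rayleigh_quotients phi N y)) as [G1 G2].
fold (inf_rayleigh phi N y) in G1, G2.
assert (G3 := G2 _ LBq).
(* A member of the set excludes the infimum + oo, just as [LBq] excludes - oo. *)
assert (inh : exists q, rayleigh_quotients phi N y q).
{ eexists; exists u1; split; [exact d1|split; [|reflexivity]].
  intros z; assert (E := z 0%Z); unfold u1, wave in E.
  pose proof (sin2_cos2 (2 * PI * eps N * 1 * 0 + (theta + alpha))) as h.
  unfold zero in E; simpl in E; unfold prod_zero, zero in E; simpl in E.
  injection E; intros E2 E1; rewrite E1 E2 in h; unfold Rsqr in h; lra. }
destruct inh as [q hq].
assert (G4 := G1 q hq).
destruct (inf_rayleigh phi N y) as [i| |]; simpl in G3, G4; try easy.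
exists (i - Rmin (A + 4 * P0) B); split; [|f_equal; ring].
assert (V1 := U1 i G1); assert (V2 := U2 i G1).
apply Rabs_le_between in hP; apply Rabs_le_between in hQ.
assert (hc2 : cos alpha ^ 2 = 1 - sin alpha ^ 2) by lra.
pose proof (pow2_ge_0 (sin alpha)); pose proof (pow2_ge_0 (cos alpha)).
pose proof (COS_bound gamma).
assert (low : 4 * P0 * sin alpha ^ 2 >= 4 * P0 * alpha ^ 2) by nra.
assert (B1 : i <= A + 4 * P0 + (8 * delta + (Q0 - 4 * P0) * alpha ^ 2)).
{ assert (P * cos alpha ^ 2 <= (P0 + delta) * cos alpha ^ 2)
    by (apply Rmult_le_compat_r; lra).
  rewrite hc2 in H2 V1; nra. }
(* As P0 <= 0, P is at most delta and its factor at most 4. The factor of Q is at most alpha^2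
   against Q0 and at most 4 against delta, which gives 8 delta in total. *)
assert (B2 : i <= B + (8 * delta + (Q0 - 4 * P0) * alpha ^ 2)).
{ assert (P * (sin alpha ^ 2 * (2 - 2 * cos gamma)) <= delta * 4).
  { assert (0 <= sin alpha ^ 2 * (2 - 2 * cos gamma) <= 4) by (split; nra).
    nra. }
  assert (Q * (cos alpha ^ 2 * (2 + 2 * cos gamma)) <= 4 * delta + Q0 * alpha ^ 2).
  { assert (0 <= cos alpha ^ 2 * (2 + 2 * cos gamma) <= 2 + 2 * cos gamma)
      by (split; nra).
    assert (cos alpha ^ 2 * (2 + 2 * cos gamma) <= 4) by lra.
    nra. }
  nra. }
unfold m in G3.
apply Rabs_le; split; [nra|].
destruct (Rmin_case_strong (A + 4 * P0) B
  (fun z => i - z <= 8 * delta + (Q0 - 4 * P0) * alpha ^ 2)); intros; lra.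
Qed.

(** * Asymptotics for both parities *)

Theorem theorem5p2 (F : R) (phi : R -> R)
  (hF : 0 < F)
  (hphi : C3_pos phi)
  (hphi1 : 0 <= Derive_n phi 1 (2 * F))
  (hphi2 : Derive_n phi 2 (2 * F) <= 0) :
  exists (C : R) (N0 : nat),
    forall (N : nat) (y : Z -> R * R),
      (3 <= N)%nat -> (N0 <= N)%nat -> uniform_circular F N y ->
      (Nat.Even N ->
        exists r : R,
          Rabs r <= C * eps N ^ 2 /\
          inf_rayleigh phi N y =
            Finite (Rmin (Derive_n phi 2 F + 4 * Derive_n phi 2 (2 * F))
                         (Derive_n phi 1 F / F) + r)) /\
      (Nat.Odd N ->
        exists r1 r2 : R,
          Rabs r1 <= C * eps N /\ Rabs r2 <= C * eps N ^ 2 /\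
          inf_rayleigh phi N y =
            Finite (Rmin (Derive_n phi 2 F + 4 * Derive_n phi 2 (2 * F))
                         (Derive_n phi 1 F / F + r1) + r2)).
Proof.
assert (h2F : 0 < 2 * F) by lra.
assert (D1 : is_derive (Derive_n phi 1) (2 * F) (Derive_n phi 2 (2 * F))).
{ apply Derive_correct; exact (proj1 (hphi _ h2F) 2%nat ltac:(lia)). }
assert (D2 : is_derive (Derive_n phi 2) (2 * F) (Derive_n phi 3 (2 * F))).
{ apply Derive_correct; exact (proj1 (hphi _ h2F) 3%nat ltac:(lia)). }
assert (D3 := is_derive_div _ _ _ _ _ D1 (is_derive_id (2 * F)) (Rgt_not_eq _ _ h2F)).
destruct (cos_eps_error _ _ _ h2F D2) as [L2 [N2 H2]].
destruct (cos_eps_error _ _ _ h2F D3) as [L1 [N1 H1]].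
set (P0 := Derive_n phi 2 (2 * F)) in *.
set (Q0 := Derive_n phi 1 (2 * F) / (2 * F)) in *.
assert (hQ0 : 0 <= Q0) by (apply Rdiv_le_0_compat; lra).
set (L := Rmax L1 L2).
(* The error bound of [inf_rayleigh_error] at delta = L eps^2, divided by eps^2. Its absolute value
   is taken below so that the bound on r1 = 0 also holds. *)
set (C := 8 * L + (Q0 - 4 * P0) * PI ^ 2).
exists (Rabs C), (5 + N1 + N2)%nat.
intros N y _ hN Hy.
assert (hN0 : (0 < N)%nat) by lia.
pose proof (eps_pos N hN0) as he.
assert (key : exists e, Rabs e <= Rabs C * eps N ^ 2 /\ inf_rayleigh phi N y =
  Finite (Rmin (Derive_n phi 2 F + 4 * P0) (Derive_n phi 1 F / F) + e)).
{ destruct (inf_rayleigh_error phi F N y P0 Q0 (L * eps N ^ 2)) as [e [he1 he2]];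
    try assumption; try lia.
  - eapply Rle_trans; [apply H2; lia|].
    apply Rmult_le_compat_r; [apply pow2_ge_0|apply Rmax_r].
  - eapply Rle_trans; [apply H1; lia|].
    apply Rmult_le_compat_r; [apply pow2_ge_0|apply Rmax_l].
  - exists e; split; [|exact he2].
    eapply Rle_trans; [exact he1|].
    apply Rle_trans with (C * eps N ^ 2).
    + right; unfold C; ring.
    + apply Rmult_le_compat_r; [apply pow2_ge_0|apply Rle_abs]. }
destruct key as [e [he1 he2]]; split; intros _.
- now exists e.
- exists 0, e; rewrite Rplus_0_r Rabs_R0; split; [|now split].
  apply Rmult_le_pos; [apply Rabs_pos|lra].
Qed.
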